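(* Let $n > 0$ be an integer and let $R$ be a ring (not necessarily commutative, not necessarily with unity) having exactly $n$ two-sided zero divisors. Then $R$ is finite and $|R| \leq (n+1)^2$.
   Context: Rings are associative, not necessarily commutative, and do not necessarily have a unity. A nonzero element $a \in R$ is a left zero divisor if there exists $b \in R$ with $b \neq 0$ such that $ab = 0$. A nonzero element $a \in R$ is a right zero divisor if there exists $b \in R$ with $b \neq 0$ such that $ba = 0$. A two-sided zero divisor is an element that is both a left zero divisor and a right zero divisor (the two witnesses $b$ need not be the same). In particular, $0$ is not counted as a zero divisor. *)

(* Defs.v *)
From HB Require Import structures.
From mathcomp Require Import all_boot all_order all_algebra.
From mathcomp Require Import classical_sets functions cardinality.
Set Implicit Arguments.
Unset Strict Implicit.
Unset Printing Implicit Defensive.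

Local Open Scope ring_scope.

(* Associative rings, not necessarily commutative or unital: MathComp's ring
   hierarchy starts at pzSemiRingType, which already has a unit.  The
   choiceType structure contained in zmodType is no restriction: classically
   every type has one (see gen_choiceMixin in boolp). *)
HB.mixin Record Zmodule_isRng R of GRing.Zmodule R := {
  rmul : R -> R -> R;
  rmulA : associative rmul;
  rmulDl : left_distributive rmul +%R;
  rmulDr : right_distributive rmul +%R;
}.

#[short(type="rngType")]
HB.structure Definition Rng := { R of Zmodule_isRng R & GRing.Zmodule R }.

Definition left_zero_divisor (R : rngType) (a : R) : Prop :=
  a <> 0 /\ exists b : R, b <> 0 /\ rmul a b = 0.

Definition right_zero_divisor (R : rngType) (a : R) : Prop :=
  a <> 0 /\ exists b : R, b <> 0 /\ rmul b a = 0.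

Definition two_sided_zero_divisor (R : rngType) (a : R) : Prop :=
  left_zero_divisor a /\ right_zero_divisor a.

(* Main.v *)
Require Import Defs.
From mathcomp Require Import all_boot all_order all_algebra.
From mathcomp Require Import classical_sets functions cardinality.
From mathcomp Require Import boolp finmap.

(** Let Z be the set of two-sided zero divisors together with 0, and fix a
two-sided zero divisor a, with a b = 0 = c a and b, c nonzero.  An additive map
on a subgroup whose values and whose kernel lie in sets A and B embeds that
subgroup into A x B ([card_le_im_ker]); both parts of the theorem come from
applying this to multiplications by a.

Finiteness ([finite_rng]).  Consider the chain of additive subgroups
  R, {x | a x a = 0}, {x | a x = 0}, {x | a x = 0 = x a}.
The maps x |-> a x a, x |-> a x, x |-> x a, defined on the first, second and
third of them, have the next one as kernel.  All their values lie in Z, because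
c and a annihilate them from the left and b and a from the right, and the last
subgroup lies in Z because a is nonzero.  So R is finite as soon as Z is.

The bound ([card_le_zdivs0X]).  This chain only gives the fourth power of the
cardinality of Z.  But in a finite ring, either every left zero divisor is also
a right one, or conversely ([one_sided_zero_divisor_finite]): an element that is
a zero divisor on one side only produces a one-sided identity, and two elements
failing on opposite sides would produce a two-sided identity, which contradicts
the failure.  In the first case every element killing a nonzero element from
the left is in Z.  This holds for x a (it kills b) and for the kernel of
x |-> x a, so the cardinality of R is at most the square of that of Z.  The
second case is symmetric, with x |-> a x. *)

Local Open Scope classical_set_scope.
Local Open Scope card_scope.
Local Open Scope nat_scope.

Import GRing.Theory.

(** * Cardinality bounds *)

(** Given injections f and g into initial segments, the pair (x, y) is coded by
the integer with quotient f x and remainder g y in the division by k. *)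
Lemma card_le_setX_II (T U : Type) (A : set T) (B : set U) (m k : nat) :
  A #<= `I_m -> B #<= `I_k -> A `*` B #<= `I_(m * k).
Proof.
move=> /pcard_leP[f] /pcard_leP[g]; pose h p := f p.1 * k + g p.2.
have gk y : B y -> g y < k by move=> By; exact: (funS (s := g)).
have h_inj : {in A `*` B &, injective h}.
  move=> [x y] [x' y'] /set_mem[/= Ax By] /set_mem[/= Ax' By']; rewrite /h /= => eq_h.
  have k_gt0 : 0 < k by exact: leq_trans (gk y By).
  have eq_f : f x = f x'.
    by have := congr1 (divn^~ k) eq_h; rewrite !divnMDl// !divn_small ?gk ?addn0.
  have eq_g : g y = g y' by move: eq_h; rewrite eq_f => /addnI.
  by congr pair; [apply: (inj (f := f)) eq_f | apply: (inj (f := g)) eq_g];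
    exact: mem_set.
rewrite -(card_le_eql (inj_card_eq h_inj)); apply: subset_card_le.
move=> _ [[x y] [/= Ax By] <-]; rewrite /h /=.
have fm : f x < m by exact: (funS (s := f)).
have {}gk := gk y By.
by rewrite (leq_trans _ (leq_mul fm (leqnn k)))// mulSn addnC ltn_add2r.
Qed.

Lemma card_le_setU1 (T : Type) (x : T) (A : set T) (n : nat) :
  A #<= `I_n -> x |` A #<= `I_(n + 1).
Proof.
elim/Pchoice: T => T in x A *; move=> An.
have finA : finite_set A by apply/finite_set_leP; exists n.
have finxA : finite_set (x |` A) by rewrite finite_setU; split.
have /finite_setP[m xAm] := finxA.
rewrite (card_le_eql xAm) card_le_II -(card_fset_set xAm) fset_setU1//.
rewrite finmap.cardfsU1 addnC leq_add ?leq_b1//.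
exact: geq_card_fset_set.
Qed.

Lemma finite_inj_surj (T : choiceType) (f : T -> T) :
  finite_set [set: T] -> injective f -> forall y, exists x, f x = y.
Proof.
move=> /finite_fsetP[X XT] f_inj y.
have inX z : z \in X by have : [set: T] z by []; rewrite XT.
have : y \in [fset f x | x in X]%fset.
  suff -> : [fset f x | x in X]%fset = X by [].
  apply/eqP; rewrite eqEfcard card_imfset//= leqnn andbT.
  by apply/fsubsetP.
by move=> /imfsetP[x _ ->]; exists x.
Qed.

Local Open Scope ring_scope.

(** Additive form of the first isomorphism theorem, as an inequality: subtracting
from x a chosen element of S with the same image sends it into the kernel. *)
Lemma card_le_im_ker (V W : zmodType) (f : V -> W) (S : set V) (A : set W)
    (B : set V) :
    (forall x y, f (x - y) = f x - f y) ->
    (forall x y, S x -> S y -> S (x - y)) ->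
    (forall x, S x -> A (f x)) -> (forall x, S x -> f x = 0 -> B x) ->
  S #<= A `*` B.
Proof.
move=> fB SB fA kerB.
pose s y := xget 0 [set x | S x /\ f x = y].
have sP x : S x -> S (s (f x)) /\ f (s (f x)) = f x.
  by move=> Sx; apply: (@xgetPex V 0 [set z | S z /\ f z = f x]); exists x.
pose h x := (f x, x - s (f x)).
have h_inj : {in S &, injective h}.
  by move=> x y _ _ [-> /addIr].
rewrite -(card_le_eql (inj_card_eq h_inj)); apply: subset_card_le.
move=> _ [x Sx <-]; have [Ss fs] := sP x Sx; split; first exact: fA.
by apply: kerB; [exact: SB | rewrite fB fs subrr].
Qed.

(** * Zero divisors in a ring without unity *)

Section Rng.
Variable R : rngType.
Implicit Types a b x y : R.

Local Notation "x *r y" := (rmul x y) (at level 40, left associativity).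

Lemma rmulBl y x x' : (x - x') *r y = x *r y - x' *r y.
Proof. by apply: (addIr (x' *r y)); rewrite -rmulDl !subrK. Qed.

Lemma rmulBr y x x' : y *r (x - x') = y *r x - y *r x'.
Proof. by apply: (addIr (y *r x')); rewrite -rmulDr !subrK. Qed.

Lemma rmul0r x : 0 *r x = 0.
Proof. by rewrite -{1}(subrr (0 : R)) rmulBl subrr. Qed.

Lemma rmulr0 x : x *r 0 = 0.
Proof. by rewrite -{1}(subrr (0 : R)) rmulBr subrr. Qed.

Definition zdivs0 : set R := 0 |` [set x | two_sided_zero_divisor x].

Lemma mem_zdivs0 x b c : b <> 0 -> x *r b = 0 -> c <> 0 -> c *r x = 0 -> zdivs0 x.
Proof.
move=> b0 xb c0 cx; have [->|x0] := pselect (x = 0); first by left.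
by right; split; (split; first exact: x0); [exists b|exists c].
Qed.

(** The three applications of [card_le_im_ker] go up the chain of subgroups
{x | a x = 0 = x a}, {x | a x = 0}, {x | a x a = 0}, R. *)
Lemma finite_rng a : two_sided_zero_divisor a -> finite_set zdivs0 ->
  finite_set [set: R].
Proof.
move=> [[a0 [b [b0 ab]]] [_ [c [c0 ca]]]] finD.
have fin_ann : finite_set [set x | a *r x = 0 /\ x *r a = 0].
  by apply: sub_finite_set finD => x [ax xa]; exact: (mem_zdivs0 _ a a).
have fin_right : finite_set [set x | a *r x = 0].
  apply: (card_le_finite _ (finite_setX finD fin_ann)).
  apply: (card_le_im_ker _ _ (rmul^~ a)) => [x y|x y /= ax ay|x /= ax|//].
  - exact: rmulBl.
  - by rewrite rmulBr ax ay subrr.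
  - apply: (mem_zdivs0 _ b a) => //; first by rewrite -rmulA ab rmulr0.
    by rewrite rmulA ax rmul0r.
have fin_mid : finite_set [set x | a *r x *r a = 0].
  apply: (card_le_finite _ (finite_setX finD fin_right)).
  apply: (card_le_im_ker _ _ (rmul a)) => [x y|x y /= ax ay|x /= ax|//].
  - exact: rmulBr.
  - by rewrite rmulBr rmulBl ax ay subrr.
  - apply: (mem_zdivs0 _ a c) => //.
    by rewrite rmulA ca rmul0r.
apply: (card_le_finite _ (finite_setX finD fin_mid)).
apply: (card_le_im_ker _ _ (fun x => a *r x *r a)) => [x y|//|x _|//].
- by rewrite rmulBr rmulBl.
- apply: (mem_zdivs0 _ b c) => //; first by rewrite -rmulA ab rmulr0.
  by rewrite !rmulA ca !rmul0r.
Qed.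

(** If x is not a right zero divisor, right multiplication by x is injective,
hence bijective: f x = x for some f, and cancelling x shows that f is a right
identity.  Dually, some y that is not a left zero divisor yields a left identity
e, and then e = e f = f.  Since f is itself a multiple g x, it kills whatever x
kills on the right, although e fixes it. *)
Lemma one_sided_zero_divisor_finite : finite_set [set: R] ->
  (forall x, left_zero_divisor x -> right_zero_divisor x) \/
  (forall x, right_zero_divisor x -> left_zero_divisor x).
Proof.
move=> finR; apply: contrapT => /not_orP[/existsNP[x] + /existsNP[y]].
move=> /not_implyP[[x0 [b [b0 xb]]] x_nr] /not_implyP[[y0 [d [d0 dy]]] y_nl].
have x_reg z : z *r x = 0 -> z = 0.
  by move=> zx; apply: contrapT => z0; apply: x_nr; split=> //; exists z.
have y_reg z : y *r z = 0 -> z = 0.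
  by move=> yz; apply: contrapT => z0; apply: y_nl; split=> //; exists z.
have mulx_inj : injective (rmul^~ x).
  by move=> z z' /= zz'; apply/subr0_eq/x_reg; rewrite rmulBl zz' subrr.
have muly_inj : injective (rmul y).
  by move=> z z' zz'; apply/subr0_eq/y_reg; rewrite rmulBr zz' subrr.
have [f fx] := finite_inj_surj _ _ finR mulx_inj x.
have [g gx] := finite_inj_surj _ _ finR mulx_inj f.
have [e ye] := finite_inj_surj _ _ finR muly_inj y.
have f_id z : z *r f = z by apply: mulx_inj; rewrite /= -rmulA fx.
have e_id z : e *r z = z by apply: muly_inj; rewrite rmulA ye.
have ef : e = f by rewrite -(f_id e) e_id.
by apply: b0; rewrite -(e_id b) ef -gx -rmulA xb rmulr0.
Qed.

(** Only one of the two one-sided multiplications by a is sure to work, depending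
on which side of zero divisors is automatically two-sided. *)
Lemma card_le_zdivs0X a : two_sided_zero_divisor a -> finite_set [set: R] ->
  [set: R] #<= zdivs0 `*` zdivs0.
Proof.
move=> [[a0 [b [b0 ab]]] [_ [c [c0 ca]]]] finR.
have [lr|rl] := one_sided_zero_divisor_finite finR.
- have zd_left x z : z <> 0 -> x *r z = 0 -> zdivs0 x.
    move=> z0 xz; have [->|x0] := pselect (x = 0); first by left.
    have x_left : left_zero_divisor x by split=> //; exists z.
    by right; split=> //; exact: lr.
  apply: (card_le_im_ker _ _ (rmul^~ a)) => // [x y|x _|x _].
  + exact: rmulBl.
  + by apply: (zd_left _ b) => //; rewrite -rmulA ab rmulr0.
  + exact: zd_left.
- have zd_right x z : z <> 0 -> z *r x = 0 -> zdivs0 x.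
    move=> z0 zx; have [->|x0] := pselect (x = 0); first by left.
    have x_right : right_zero_divisor x by split=> //; exists z.
    by right; split=> //; exact: rl.
  apply: (card_le_im_ker _ _ (rmul a)) => // [x y|x _|x _].
  + exact: rmulBr.
  + by apply: (zd_right _ c) => //; rewrite rmulA ca rmul0r.
  + exact: zd_right.
Qed.

End Rng.

Local Close Scope ring_scope.

Theorem mainTheorem1 (n : nat) (R : rngType) (n_gt0 : 0 < n)
    (hR : [set x : R | two_sided_zero_divisor x] #= `I_n) :
  finite_set [set: R] /\ [set: R] #<= `I_((n + 1) ^ 2).
Proof.
have cardZD : zdivs0 R #<= `I_(n + 1).
  by apply: card_le_setU1; move: hR; rewrite card_eq_le => /andP[].
have finZD : finite_set (zdivs0 R).
  by apply/finite_set_leP; exists (n + 1).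
have [a aD] : exists a : R, two_sided_zero_divisor a.
  apply: contrapT => /forallNP D_empty.
  have : `I_n #<= [set x : R | two_sided_zero_divisor x].
    by move: hR; rewrite card_eq_le => /andP[].
  have -> : [set x : R | two_sided_zero_divisor x] = set0.
    by apply/seteqP; split=> // x /D_empty.
  by rewrite card_le0 => /eqP/IIn_eq0 n0; rewrite n0 in n_gt0.
have finR := finite_rng _ _ aD finZD; split=> //.
apply: card_le_trans (card_le_zdivs0X _ _ aD finR) _.
exact: card_le_setX_II.
Qed.
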